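(* Let $k\ge 2$ and let $G$ be an irregular connected $k$-uniform hypergraph with $n$ vertices and $m$ edges, maximum degree $\Delta$, minimum degree $\delta$, diameter $D$ and spectral radius $\rho(G)$. Then $$\rho(G)<\Delta-\frac{k(n\Delta-km)}{\left[2(k-1)D(n\Delta-km)+k\right]\left[\left(\frac{\delta}{\Delta}\right)^{\frac{k}{2(k-1)}}+n-1\right]}.$$
   Context: A $k$-uniform hypergraph $G$ has a finite vertex set $V(G)=\{1,\dots,n\}$ and a set $E(G)$ of edges, each of which is a set of exactly $k$ distinct vertices. The degree $d_i$ of a vertex $i$ is the number of edges containing $i$; $\Delta=\max_i d_i$, $\delta=\min_i d_i$. $G$ is regular if all vertices have the same degree, and irregular otherwise. A path from $u$ to $v$ is an alternating sequence $v_0e_1v_1e_2\cdots v_{l-1}e_lv_l$ with $v_0=u$, $v_l=v$, where the vertices $v_0,\dots,v_l$ are distinct, the edges $e_1,\dots,e_l$ are distinct, and $v_{i-1},v_i\in e_i$ for $i=1,\dots,l$; its length is $l$. $G$ is connected if there is a path between any two vertices. The distance between two distinct vertices is the length of a shortest path connecting them, and the diameter $D$ is the maximum distance between vertices of $G$. The adjacency tensor of $G$ is $\mathcal{A}_G=(a_{i_1\cdots i_k})$, of order $k$ and dimension $n$, with $a_{i_1\cdots i_k}=\frac{1}{(k-1)!}$ if $\{i_1,\dots,i_k\}\in E(G)$ and $a_{i_1\cdots i_k}=0$ otherwise. For $x\in\mathbb{C}^n$, $\mathcal{A}_Gx^{k-1}\in\mathbb{C}^n$ has $i$-th component $\sum_{i_2,\dots,i_k=1}^n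 a_{ii_2\cdots i_k}x_{i_2}\cdots x_{i_k}$. A number $\lambda\in\mathbb{C}$ is an eigenvalue of $\mathcal{A}_G$ with eigenvector $x\in\mathbb{C}^n\setminus\{0\}$ if $\mathcal{A}_Gx^{k-1}=\lambda x^{[k-1]}$, where $x^{[k-1]}=(x_1^{k-1},\dots,x_n^{k-1})^{\mathrm T}$. The spectral radius $\rho(G)$ is the maximum modulus of the eigenvalues of $\mathcal{A}_G$. *)

(* Defs.v *)
From HB Require Import structures.
From mathcomp Require Import all_boot all_order all_algebra.
From mathcomp Require Import complex.
From mathcomp Require Import boolp classical_sets reals exp.

Set Implicit Arguments.
Unset Strict Implicit.
Unset Printing Implicit Defensive.

Import Order.TTheory GRing.Theory Num.Theory.

Local Open Scope ring_scope.

Section Hypergraph.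

Record hypergraph (k n : nat) := Hypergraph {
  edges : {set {set 'I_n}};
  card_edge : forall e, e \in edges -> #|e| = k }.

Variables (k n : nat) (G : hypergraph k n).
Implicit Types (i u v : 'I_n) (l : nat).

Definition num_edges : nat := #|edges G|.

Definition degree i : nat := #|[set e in edges G | i \in e]%SET|.

Definition max_degree : nat := (\max_i degree i)%N.

(* Every degree is at most num_edges, so for n > 0 the unit of this iterated
   minimum does not affect its value. *)
Definition min_degree : nat := \big[minn/num_edges]_i degree i.

Definition regular : Prop := forall i j, degree i = degree j.

Definition irregular : Prop := ~ regular.

(* The path v_0 e_1 v_1 ... e_l v_l is encoded by vs = (v_0, ..., v_l) and
   es = (e_1, ..., e_l); since es is indexed from 0, its i-th entry is
   e_(i+1), which has to contain v_i and v_(i+1). *)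
Definition is_path l u v (vs : l.+1.-tuple 'I_n) (es : l.-tuple {set 'I_n}) :=
  [&& nth u vs 0 == u, nth u vs l == v,
      uniq vs, uniq es, all (mem (edges G)) es &
      [forall i : 'I_l, (nth u vs i \in tnth es i)
                     && (nth u vs i.+1 \in tnth es i)]].

Definition has_path u v l : bool :=
  [exists vs : l.+1.-tuple 'I_n,
     [exists es : l.-tuple {set 'I_n}, is_path u v vs es]].

Definition connected : Prop := forall u v, exists l, has_path u v l.

(* The vertices of a path are distinct, so its length is less than n: this is
   the least length of a path from u to v (see distP), and the junk value n
   when there is none. *)
Definition dist u v : nat := find (has_path u v) (iota 0 n).

Definition diameter : nat := (\max_u \max_(v | v != u) dist u v)%N.

Lemma has_path_lt u v l : has_path u v l -> (l < n)%N.
Proof.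
case/existsP=> vs /existsP [es /and5P [_ _ uvs _ _]].
by rewrite -(size_tuple vs) -(card_uniqP uvs) -[leqRHS]card_ord max_card.
Qed.

Lemma distP u v : (exists l, has_path u v l) ->
  has_path u v (dist u v) /\ forall l, has_path u v l -> (dist u v <= l)%N.
Proof.
move=> [l0 hl0].
have hs : has (has_path u v) (iota 0 n).
  by apply/hasP; exists l0; rewrite // mem_iota (has_path_lt hl0).
have lt_d : (dist u v < n)%N by rewrite -[ltnRHS](size_iota 0 n) -has_find.
split=> [|l hl].
  by have := nth_find 0 hs; rewrite nth_iota.
rewrite leqNgt; apply/negP=> lt_l.
have := before_find 0 lt_l.
by rewrite nth_iota ?(has_path_lt hl)// add0n hl.
Qed.

End Hypergraph.

Section Tensor.

Variables (C : numClosedFieldType) (d n : nat).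

(* Tensors of order d.+1 and dimension n. *)
Definition tensor := d.+1.-tuple 'I_n -> C.

Definition tensor_apply (T : tensor) (x : 'cV[C]_n) : 'cV[C]_n :=
  \col_i \sum_(s : d.-tuple 'I_n) T [tuple of i :: s] * \prod_(j <- s) x j 0.

Definition tensor_eigenvalue (T : tensor) (lambda : C) : Prop :=
  exists2 x : 'cV[C]_n, x != 0 &
    tensor_apply T x = lambda *: \col_i (x i 0 ^+ d).

End Tensor.

Section SpectralRadius.

Variables (R : realType) (k n : nat) (G : hypergraph k n).

(* The order k.-1.+1 equals k for k > 0. *)
Definition adjacency_tensor : tensor (complex R) k.-1 n :=
  fun s => if [set:: s] \in edges G then (k.-1)`!%:R^-1 else 0.

Definition eigenvalue_moduli : set R :=
  [set ComplexField.Normc.normc lambda |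
    lambda in tensor_eigenvalue adjacency_tensor]%classic.

(* For k >= 2 and n > 0 this set is nonempty and compact, so its supremum is
   its maximum. *)
Definition spectral_radius : R := sup eigenvalue_moduli.

Lemma spectral_radius_max r :
  eigenvalue_moduli r -> (forall s, eigenvalue_moduli s -> s <= r) ->
  spectral_radius = r.
Proof.
move=> hr ub; apply/eqP; rewrite eq_le; apply/andP; split.
  by apply: ge_sup => //; exists r.
by apply: ub_le_sup => //; exists r.
Qed.

End SpectralRadius.

(* Main.v *)
From mathcomp Require Import all_boot all_order all_algebra complex.
From mathcomp Require Import ring lra zify.
From mathcomp Require Import boolp classical_sets reals topology normedtype.
From mathcomp Require Import derive exp realfun.
Require Import Defs.

(** Write [F x] for the sum over the edges [e] of [\prod_(j in e) x j].  Two
    facts take the place of the Perron-Frobenius theory of the adjacency tensor.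

    Let [x] maximize [F] among the nonnegative vectors with
    [\sum_i x i ^+ k = 1] ([edge_form_maximizer]), and put [mu = k * F x].  The
    moduli of an eigenvector satisfy the eigenvalue equation as an inequality,
    so [mu] bounds the modulus of every eigenvalue ([spectral_radius_le]).  On
    the other hand [x] satisfies the eigenvalue equation for [mu]
    ([maximizer_eigen]).

    It remains to bound [Delta - mu] from below.  It is the sum of
    [\sum_i (Delta - d_i) * x i ^+ k], where [d_i] are the degrees, and of the
    edge defects [\sum_(j in e) x j ^+ k - k * \prod_(j in e) x j].  With
    [A = n * Delta - k * m], the sum of the [Delta - d_i], the first part is at
    least [A * b ^+ k], where [b] is the least entry of [x].  With
    [f i = Num.sqrt (x i) ^+ k], a defect is at least
    [k / (2 * (k - 1)) * (f p - f q) ^+ 2] for any two vertices [p] and [q] of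
    the edge ([edge_defect_ge]).  By Cauchy-Schwarz along a shortest path from
    a vertex with the largest entry [a] to one with the least, the defects add up
    to at least [k / (2 * (k - 1) * D)] times the square of the difference of
    the values of [f] at these two vertices.  Minimizing over [b] leaves
    [k * A * a ^+ k / (2 * (k - 1) * D * A + k)] ([gap_lower_bound]).

    Finally, the eigenvalue equation at vertices of maximum and minimum degree
    yields [b ^+ k <= theta * a ^+ k] for the power [theta] of [delta / Delta]
    in the statement, hence [1 = \sum_i x i ^+ k <= (theta + n - 1) * a ^+ k].
    The last inequality is strict ([max_entry_power_gt]), and this makes the
    bound strict. *)

Set Implicit Arguments.
Unset Strict Implicit.
Unset Printing Implicit Defensive.

Import Order.TTheory GRing.Theory Num.Theory.
Import numFieldNormedType.Exports.

Local Open Scope ring_scope.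

(** * Inequalities for real numbers *)

(** The right-hand side is the sum of [r i ^+ k * r j ^+ k] over the ordered
    pairs of distinct elements of [e], with [k = #|e|].  The product of these
    terms is [\prod_(j in e) r j ^+ 2] to the power [k * k.-1], which is the
    number of pairs, so this is the inequality between their arithmetic and
    geometric means. *)
Lemma mean_offdiag_ge (R : realFieldType) (I : finType) (e : {set I})
    (r : I -> R) :
  (1 < #|e|)%N -> (forall i, 0 <= r i) ->
  (#|e| * #|e|.-1)%:R * \prod_(j in e) r j ^+ 2
    <= (\sum_(j in e) r j ^+ #|e|) ^+ 2 - \sum_(j in e) (r j ^+ #|e|) ^+ 2.
Proof.
set k := #|e| => e_gt1 r0; pose f i := r i ^+ k.
have f0 i : 0 <= f i by rewrite exprn_ge0.
pose A := [pred p : I * I | (p.1 \in e) && (p.2 \in e :\ p.1)].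
pose E (p : I * I) := f p.1 * f p.2.
have cardD i : i \in e -> #|e :\ i| = k.-1.
  by move=> ie; rewrite /k (cardsD1 i e) ie.
have cardA : #|A| = (k * k.-1)%N.
  rewrite -sum1_card -(pair_big_dep (mem e) (fun i j => j \in e :\ i)
    (fun _ _ => 1%N)).
  by under eq_bigr => i ie do rewrite sum1_card cardD//; rewrite sum_nat_const.
have sumA :
    \sum_(p in A) E p = (\sum_(j in e) f j) ^+ 2 - \sum_(j in e) f j ^+ 2.
  rewrite -(pair_big_dep (mem e) (fun i j => j \in e :\ i)
    (fun i j => f i * f j)).
  rewrite expr2 mulr_suml -sumrB; apply: eq_bigr => i ie.
  rewrite -mulr_sumr (big_setD1 i ie) /= mulrDr expr2.
  by rewrite [X in X - _]addrC addrK.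
have prodA : \prod_(p in A) E p = (\prod_(j in e) r j ^+ 2) ^+ (k * k.-1).
  rewrite -(pair_big_dep (mem e) (fun i j => j \in e :\ i)
    (fun i j => f i * f j)).
  under eq_bigr => i ie do rewrite big_split /= prodr_const cardD//.
  rewrite big_split /= (exchange_big_dep (mem e)) /=; last first.
    by move=> i j _ /setD1P[].
  rewrite [X in _ * X](eq_bigr (fun j => f j ^+ k.-1)); last first.
    move=> j je; rewrite -(cardD j je) -prodr_const; apply: eq_bigl => i.
    by rewrite !inE je andbT andbC eq_sym.
  rewrite -big_split /= -prodrXl; apply: eq_bigr => i _.
  by rewrite /f -!exprM -exprD -mulnDr addnn -mul2n mulnA (mulnC _ 2) mulnA.
have /leif_AGM[+ _] : {in A, forall p, 0 <= E p} by move=> p _; apply: mulr_ge0.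
rewrite cardA prodA; set S := \sum_(p in A) E p => le_pow.
have m0 : (0 < k * k.-1)%N by rewrite muln_gt0; lia.
have S0 : 0 <= S by apply: sumr_ge0 => p _; apply: mulr_ge0.
suff : (k * k.-1)%:R * \prod_(j in e) r j ^+ 2 <= S by rewrite /S sumA.
rewrite mulrC -ler_pdivlMr ?ltr0n// -(ler_pXn2r m0)// nnegrE.
  by apply: prodr_ge0 => j _; apply: sqr_ge0.
by rewrite divr_ge0// ler0n.
Qed.

(** Up to the factor [2 * #|e|] the right-hand side is the sum of the squared
    deviations of [f] from its mean on [e]; the deviations at [p] and [q] alone
    account for at least half of [(f p - f q) ^+ 2]. *)
Lemma variance_ge (R : realFieldType) (I : finType) (e : {set I}) (f : I -> R)
    p q :
  p \in e -> q \in e ->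
  #|e|%:R * (f p - f q) ^+ 2
    <= 2 * (#|e|%:R * \sum_(j in e) f j ^+ 2 - (\sum_(j in e) f j) ^+ 2).
Proof.
move=> pe qe; set k := #|e|; set S := \sum_(j in e) f j.
have k0 : 0 < k%:R :> R by rewrite ltr0n; apply/card_gt0P; exists p.
pose c := S / k%:R.
have cS : k%:R * c = S by rewrite mulrC divfK ?gt_eqF.
have sumE :
    \sum_(j in e) (f j - c) ^+ 2 = \sum_(j in e) f j ^+ 2 - k%:R * c ^+ 2.
  transitivity (\sum_(j in e) f j ^+ 2 - 2 * c * S + k%:R * c ^+ 2).
    rewrite /k -sum1_card natr_sum mulr_suml mulr_sumr -sumrB -big_split /=.
    by apply: eq_bigr => j _; ring.
  by rewrite -cS; ring.
have two : (f p - f q) ^+ 2 <= 2 * \sum_(j in e) (f j - c) ^+ 2.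
  have [<-|pq] := eqVneq p q.
    by rewrite subrr expr0n mulr_ge0// sumr_ge0// => j _; apply: sqr_ge0.
  rewrite (big_setD1 p pe) (big_setD1 q) /=; last by rewrite !inE eq_sym pq.
  have := sqr_ge0 (f p - c + (f q - c)).
  have : 0 <= \sum_(i in e :\ p :\ q) (f i - c) ^+ 2.
    by apply: sumr_ge0 => j _; apply: sqr_ge0.
  by lra.
have := ler_wpM2l (ltW k0) two; rewrite sumE => /le_trans; apply.
by rewrite -cS; lra.
Qed.

(** A quantitative inequality between the arithmetic and geometric means of the
    [x j ^+ k], [k = #|e|].  Adding the previous two lemmas for
    [f i = Num.sqrt (x i) ^+ k] cancels the square of the sum of [f]. *)
Lemma edge_defect_ge (R : rcfType) (I : finType) (e : {set I}) (x : I -> R)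
    p q :
  (1 < #|e|)%N -> (forall i, 0 <= x i) -> p \in e -> q \in e ->
  #|e|%:R * (Num.sqrt (x p) ^+ #|e| - Num.sqrt (x q) ^+ #|e|) ^+ 2
    <= 2 * (#|e|%:R - 1) *
         (\sum_(j in e) x j ^+ #|e| - #|e|%:R * \prod_(j in e) x j).
Proof.
move=> e_gt1 x0 pe qe.
have := mean_offdiag_ge e_gt1 (fun i => sqrtr_ge0 (x i)).
have := variance_ge (fun i => Num.sqrt (x i) ^+ #|e|) pe qe.
rewrite /= (eq_bigr (fun j => x j ^+ #|e|)); last first.
  by move=> j _; rewrite exprAC sqr_sqrtr.
rewrite [\prod_(j in e) _](eq_bigr x); last first.
  by move=> j _; rewrite sqr_sqrtr.
rewrite natrM -subn1 natrB; last exact: ltnW.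
by lra.
Qed.

(** The Cauchy-Schwarz inequality for the telescoping sum of the increments
    of [g]. *)
Lemma sqr_telescope_le (R : realFieldType) (g : nat -> R) l :
  (g 0%N - g l) ^+ 2 <= l%:R * \sum_(i < l) (g i - g i.+1) ^+ 2.
Proof.
elim: l => [|[_|l IHl]]; first by rewrite subrr expr0n mul0r.
  by rewrite big_ord1 mul1r.
rewrite big_ord_recr /=; set S := \sum_(i < l.+1) _ in IHl *.
have S0 : 0 <= S by apply: sumr_ge0 => i _; apply: sqr_ge0.
set a := g 0%N - g l.+1 in IHl; set b := g l.+1 - g l.+2.
have -> : g 0%N - g l.+2 = a + b by rewrite /a /b; ring.
rewrite -[l.+2%:R]natr1; set t : R := l.+1%:R in IHl *.
have t0 : 0 < t by rewrite ltr0n.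
suff : 2 * a * b <= S + t * b ^+ 2 by lra.
rewrite -(ler_pM2l t0).
by have := sqr_ge0 (a - t * b); lra.
Qed.

(** For [0 < c] the hypothesis bounds [E] by [k * (a - b) ^+ 2 / c], and the
    minimum over [b] of [A * b ^+ 2 + k * (a - b) ^+ 2 / c] is
    [k * A * a ^+ 2 / (c * A + k)]. *)
Lemma quadratic_tradeoff (R : realFieldType) (A E a b c k : R) :
  0 <= A -> 0 <= E -> 0 <= c -> 0 <= k -> k * (a - b) ^+ 2 <= c * E ->
  k * A * a ^+ 2 <= (c * A + k) * (A * b ^+ 2 + E).
Proof.
move=> A0 E0 c0 k0 h.
suff : 2 * k * A * b * (a - b) <= c * A ^+ 2 * b ^+ 2 + k * E.
  have := ler_wpM2l A0 h; lra.
(* With c = 0 the hypothesis forces a = b, unless k = 0. *)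
have [c_eq0|c_neq0] := eqVneq c 0.
  have kt : k * (a - b) = 0.
    apply/eqP; rewrite -(sqrf_eq0); apply/eqP/le_anti; rewrite sqr_ge0 andbT.
    have := ler_wpM2l k0 h; rewrite c_eq0; lra.
  have -> : 2 * k * A * b * (a - b) = 2 * A * b * (k * (a - b)) by ring.
  by rewrite kt c_eq0 mulr0; have := mulr_ge0 k0 E0; lra.
have c_gt0 : 0 < c by lra.
rewrite -(ler_pM2l c_gt0).
(* The minimizing b is the one for which this square vanishes. *)
have := sqr_ge0 (c * A * b - k * (a - b)); have := ler_wpM2l k0 h; lra.
Qed.

Lemma powR_half_ratio (R : realType) (k : nat) (z r : R) :
  (1 < k)%N -> 0 <= z -> 0 <= r ->
  (z ^+ k.-1 ^+ 2 <= r -> z ^+ k <= r `^ (k%:R / (2 * (k%:R - 1)))) /\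
  (z ^+ k.-1 ^+ 2 < r -> z ^+ k < r `^ (k%:R / (2 * (k%:R - 1)))).
Proof.
move=> k1 z0 r0; set p := k%:R / _.
have k1R : 1 < k%:R :> R by rewrite ltr1n.
have p0 : 0 < p by rewrite divr_gt0; lra.
have zE : z ^+ k = (z ^+ k.-1 ^+ 2) `^ p.
  rewrite -exprM -!powR_mulrn // -powRrM; congr (_ `^ _).
  rewrite natrM -subn1 natrB /p; last exact: ltnW.
  by field; rewrite subr_eq0 gt_eqF.
rewrite zE; split => h.
  by apply: ge0_ler_powR; rewrite ?nnegrE ?exprn_ge0 // ltW.
by apply: gt0_ltr_powR; rewrite ?nnegrE ?exprn_ge0.
Qed.

(** * Degrees and the form of a hypergraph *)

Section Degrees.

Variables (k n : nat) (G : hypergraph k n).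

Lemma degree_le_num_edges i : (degree G i <= num_edges G)%N.
Proof.
by apply: subset_leq_card; apply/fintype.subsetP => e; rewrite inE => /andP[].
Qed.

Lemma max_degree_ge i : (degree G i <= max_degree G)%N.
Proof. exact: leq_bigmax. Qed.

Lemma max_degree_attained : (0 < n)%N -> exists u, degree G u = max_degree G.
Proof.
move=> n0; have : (0 < #|'I_n|)%N by rewrite card_ord.
by move=> /(bigop.eq_bigmax (degree G))[u uE]; exists u; rewrite /max_degree uE.
Qed.

Lemma min_degree_le i : (min_degree G <= degree G i)%N.
Proof.
rewrite /min_degree; elim: (index_enum _) (mem_index_enum i) => //= j s IHs.
rewrite inE big_cons => /predU1P[->|/IHs]; first exact: geq_minl.
exact/leq_trans/geq_minr.
Qed.

Lemma min_degree_attained : (0 < n)%N -> exists v, degree G v = min_degree G.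
Proof.
move=> n0; pose v := [arg min_(i < Ordinal n0) degree G i].
exists v; apply/eqP; rewrite eqn_leq min_degree_le andbT /v.
case: arg_minnP => // {}v _ vmin; rewrite /min_degree.
elim/big_ind: _ => [|a b ha hb|i _]; first exact: degree_le_num_edges.
  by rewrite leq_min ha.
exact: vmin.
Qed.

Lemma irregular_card_gt1 : irregular G -> (1 < n)%N.
Proof.
move=> irr; rewrite ltnNge; apply/negP => n1; apply: irr => i j; congr degree.
by apply: val_inj; case: i j => i /= ? [j /= ?]; lia.
Qed.

Lemma irregular_lt_max : irregular G -> exists i, (degree G i < max_degree G)%N.
Proof.
move=> irr.
case: (pickP (fun i => degree G i < max_degree G)%N) => [i|h].
  by exists i.
case: irr => i j; transitivity (max_degree G).
  by apply/eqP; rewrite eqn_leq max_degree_ge leqNgt h.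
by apply/eqP; rewrite eqn_leq max_degree_ge leqNgt h.
Qed.

Lemma dist_le_diameter u v : u != v -> (dist G u v <= diameter G)%N.
Proof.
move=> uv; rewrite /diameter.
apply: leq_trans (leq_bigmax u); rewrite (bigop.bigmax_sup v) // eq_sym //.
Qed.

(** A path from [i] to any other vertex starts with an edge at [i]. *)
Lemma connected_degree_gt0 i : (1 < n)%N -> connected G -> (0 < degree G i)%N.
Proof.
move=> n1 conn; have [j ji] : exists j : 'I_n, j != i.
  have : (1 < #|'I_n|)%N by rewrite card_ord.
  by rewrite (cardD1 i) => /card_gt0P[j]; rewrite inE => /andP[]; exists j.
have [l /existsP[vs /existsP[es]]] := conn i j.
move=> /and5P[/eqP v0 /eqP vl _ _ /andP[/allP es_edge /forallP es_vs]].
case: l => [|l] in vs es v0 vl es_edge es_vs *.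
  by case/eqP: ji; rewrite -vl.
have /andP[ie _] := es_vs ord0.
apply/card_gt0P; exists (tnth es ord0); rewrite v0 in ie; rewrite inE ie andbT.
exact/es_edge/mem_tnth.
Qed.

Lemma sum_degree (R : pzSemiRingType) (y : 'I_n -> R) :
  \sum_i (degree G i)%:R * y i = \sum_(e in edges G) \sum_(j in e) y j.
Proof.
rewrite (exchange_big_dep predT) //=; apply: eq_bigr => i _.
rewrite /degree -sum1_card natr_sum mulr_suml.
by apply: eq_big => [e|e _]; rewrite ?inE ?mul1r.
Qed.

Lemma handshake (R : pzSemiRingType) :
  \sum_i (degree G i)%:R = (k * num_edges G)%:R :> R.
Proof.
under eq_bigr do rewrite -[_%:R]mulr1; rewrite sum_degree.
under eq_bigr => e eE do rewrite sumr_const (card_edge eE).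
by rewrite sumr_const -mulrnA.
Qed.

End Degrees.

Section EdgeForm.

Variables (R : realFieldType) (k n : nat) (G : hypergraph k n).
Implicit Types x : 'I_n -> R.

(** For the adjacency tensor [T] of [G] the form [T x^k] equals
    [k%:R * edge_form x], and [T x^(k-1)] has the components [link_form x i]. *)
Definition edge_form x : R := \sum_(e in edges G) \prod_(j in e) x j.

Definition link_form x (i : 'I_n) : R :=
  \sum_(e in edges G | i \in e) \prod_(j in e :\ i) x j.

(** Euler's identity for the form [edge_form], homogeneous of degree [k]. *)
Lemma sum_link_form x : \sum_i x i * link_form x i = k%:R * edge_form x.
Proof.
under eq_bigr do rewrite mulr_sumr.
rewrite (exchange_big_dep (mem (edges G))) /=; last by move=> i e _ /andP[].
rewrite mulr_sumr; apply: eq_bigr => e eE.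
under eq_bigl do rewrite eE; rewrite -(card_edge eE) mulr_natl -sumr_const.
by apply: eq_bigr => i ie; rewrite (big_setD1 i ie).
Qed.

(** An edge contains a vertex at most once, so the form is affine in each
    coordinate. *)
Lemma edge_form_split x i : exists c, forall t,
  edge_form (fun j => if j == i then t else x j) = c + t * link_form x i.
Proof.
exists (\sum_(e in edges G | i \notin e) \prod_(j in e) x j) => t.
rewrite /edge_form (bigID (fun e : {set 'I_n} => i \in e)) /= addrC mulr_sumr.
congr (_ + _); apply: eq_bigr => e /andP[eE ie].
  by apply: eq_bigr => j je; case: eqVneq => // ji; rewrite -ji je in ie.
rewrite (big_setD1 i ie) /= eqxx; congr (_ * _).
by apply: eq_bigr => j /setD1P[/negbTE ->].
Qed.

Lemma prod_edgeD1_ge x (b : R) e i :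
  0 <= b -> (forall j, j != i -> b <= x j) -> e \in edges G -> i \in e ->
  b ^+ k.-1 <= \prod_(j in e :\ i) x j.
Proof.
move=> b0 bx eE ie; rewrite -(card_edge eE) (cardsD1 i) ie /= -prodr_const.
by apply: ler_prod => j /setD1P[ji _]; rewrite b0 bx.
Qed.

Lemma degreeE i : (degree G i)%:R = \sum_(e in edges G | i \in e) 1 :> R.
Proof.
by rewrite /degree -sum1_card natr_sum; apply: eq_bigl => e; rewrite inE.
Qed.

Lemma link_form_ge x (b : R) i : 0 <= b -> (forall j, j != i -> b <= x j) ->
  (degree G i)%:R * b ^+ k.-1 <= link_form x i.
Proof.
move=> b0 bx; rewrite degreeE mulr_suml; apply: ler_sum => e /andP[eE ie].
by rewrite mul1r prod_edgeD1_ge.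
Qed.

Lemma link_form_le x (a : R) i : (forall j, 0 <= x j <= a) ->
  link_form x i <= (degree G i)%:R * a ^+ k.-1.
Proof.
move=> xa; rewrite degreeE mulr_suml; apply: ler_sum => e /andP[eE ie].
rewrite mul1r -(card_edge eE) [#|e|](cardsD1 i) ie /= -prodr_const.
exact: ler_prod.
Qed.

(** The bound of [f] along a path by Cauchy-Schwarz costs the length [l]; the
    edges of a path are distinct, so that each edge weight is used at most
    once. *)
Lemma path_energy_le (W : {set 'I_n} -> R) (f : 'I_n -> R) (c : R) u v l :
  0 <= c -> (forall e, e \in edges G -> 0 <= W e) ->
  (forall e p q, e \in edges G -> p \in e -> q \in e ->
     c * (f p - f q) ^+ 2 <= W e) ->
  has_path G u v l ->
  c * (f u - f v) ^+ 2 <= l%:R * \sum_(e in edges G) W e.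
Proof.
move=> c0 W0 hW /existsP[vs /existsP[es]].
move=> /and5P[/eqP v0 /eqP vl _ es_uniq /andP[/allP es_edge /forallP es_vs]].
have step (i : 'I_l) :
    c * (f (nth u vs i) - f (nth u vs i.+1)) ^+ 2 <= W (tnth es i).
  by have /andP[? ?] := es_vs i; apply: hW => //; apply/es_edge/mem_tnth.
have := sqr_telescope_le (fun i => f (nth u vs i)) l; rewrite /= v0 vl.
move=> /(ler_wpM2l c0)/le_trans; apply.
rewrite mulrCA; apply: ler_wpM2l; first exact: ler0n.
rewrite mulr_sumr; apply: (le_trans (ler_sum _ (fun i _ => step i))).
rewrite -(big_tuple _ _ es xpredT W) big_uniq //.
rewrite [leRHS](bigID (mem es)) /= -[leLHS]addr0; apply: lerD.
  rewrite le_eqVlt; apply/orP; left; apply/eqP/eq_bigl => e.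
  case: (boolP (e \in es)) => [ees|_]; last by rewrite andbF.
  by have eE : e \in edges G := es_edge _ ees; rewrite eE.
by apply: sumr_ge0 => e /andP[/W0].
Qed.

Lemma edge_form0 x : (0 < k)%N -> (forall i, x i = 0) -> edge_form x = 0.
Proof.
move=> k0 x0; rewrite /edge_form big1 // => e eE.
have /card_gt0P[i ie] : (0 < #|e|)%N by rewrite (card_edge eE).
by rewrite (big_setD1 i ie) /= x0 mul0r.
Qed.

Lemma edge_formZ (c : R) x :
  edge_form (fun i => c * x i) = c ^+ k * edge_form x.
Proof.
rewrite /edge_form mulr_sumr; apply: eq_bigr => e eE.
by rewrite big_split /= prodr_const (card_edge eE).
Qed.

Lemma edge_form_ge0 x : (forall i, 0 <= x i) -> 0 <= edge_form x.
Proof. by move=> x0; apply: sumr_ge0 => e _; apply: prodr_ge0. Qed.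

Lemma link_form_ge0 x i : (forall j, 0 <= x j) -> 0 <= link_form x i.
Proof. by move=> x0; apply: sumr_ge0 => e _; apply: prodr_ge0. Qed.

End EdgeForm.

(** * The spectral radius and the maximum of the form *)

Section Eigenvalues.

Variables (R : realType) (k n : nat) (G : hypergraph k n).
Local Notation normc := (@ComplexField.Normc.normc R).

Lemma normc_sum (I : Type) (s : seq I) (P : pred I) (F : I -> complex R) :
  normc (\sum_(i <- s | P i) F i) <= \sum_(i <- s | P i) normc (F i).
Proof.
elim/big_ind2: _ => [|a b c d hb hd|//].
  by rewrite ComplexField.Normc.normc0.
exact: le_trans (le_normcD _ _) (lerD hb hd).
Qed.

Lemma normc_prod (I : Type) (s : seq I) (P : pred I) (F : I -> complex R) :
  normc (\prod_(i <- s | P i) F i) = \prod_(i <- s | P i) normc (F i).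
Proof.
apply: (big_morph normc); first exact: ComplexField.Normc.normcM.
exact: ComplexField.Normc.normc1.
Qed.

Lemma normcX (z : complex R) m : normc (z ^+ m) = normc z ^+ m.
Proof.
elim: m => [|m IHm]; first exact: ComplexField.Normc.normc1.
by rewrite !exprS ComplexField.Normc.normcM IHm.
Qed.

Lemma normc_ge0 (z : complex R) : 0 <= normc z.
Proof. by case: z => a b; exact: sqrtr_ge0. Qed.

Lemma normc_natV (m : nat) : normc m%:R^-1 = m%:R^-1.
Proof.
rewrite ComplexField.Normc.normcV; congr (_^-1).
by rewrite normcMn ComplexField.Normc.normc1.
Qed.

(** The tuples in the sum enumerate [e :\ i] without repetition, so there are at
    most [(k.-1)`!] of them, and they all have the same product. *)
Lemma adjacency_fiber_le (y : 'I_n -> R) (i : 'I_n) e :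
  (forall j, 0 <= y j) -> e \in edges G -> i \in e ->
  \sum_(s : k.-1.-tuple 'I_n | [set:: i :: s] == e)
     (k.-1)`!%:R^-1 * \prod_(j <- s) y j
  <= \prod_(j in e :\ i) y j.
Proof.
move=> y0 eE ie.
have cardD : #|e :\ i| = k.-1 by rewrite -(card_edge eE) (cardsD1 i e) ie.
have uniqs (s : k.-1.-tuple 'I_n) : [set:: i :: s] == e ->
    uniq s /\ (s : seq _) =i e :\ i.
  move=> /eqP se.
  have : uniq (i :: s).
    apply/card_uniqP; rewrite /= size_tuple.
    transitivity #|e|; first by rewrite -se cardsE.
    by rewrite (cardsD1 i e) ie cardD.
  move=> /= /andP[is_ us]; split=> // j.
  by rewrite -se !inE; case: eqVneq => [->|//]; exact: negbTE.
pose fib := [set s : k.-1.-tuple 'I_n | [set:: i :: s] == e].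
have fibE (s : k.-1.-tuple 'I_n) : [set:: i :: s] == e ->
    (k.-1)`!%:R^-1 * \prod_(j <- s) y j =
      (k.-1)`!%:R^-1 * \prod_(j in e :\ i) y j.
  move=> /uniqs[us sE]; rewrite big_uniq //; congr (_ * _).
  by apply: eq_bigl => j; rewrite -sE.
rewrite (eq_bigr _ fibE) (eq_bigl (fun s => s \in fib)); last first.
  by move=> s; rewrite inE.
rewrite sumr_const -mulrnAl -[_^-1 *+ _]mulr_natl.
apply: ler_piMl; first exact: prodr_ge0.
rewrite ler_pdivrMr ?ltr0n ?fact_gt0 // mul1r ler_nat.
have -> : (k.-1)`! =
    #|[set t : k.-1.-tuple 'I_n | all (mem (e :\ i)) t & uniq t]|.
  by rewrite card_uniq_tuples cardD ffactnn.
apply: subset_leq_card; apply/fintype.subsetP => s.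
rewrite !inE => /uniqs[us sE].
by rewrite us andbT; apply/allP => j; rewrite sE.
Qed.

(** The triangle inequality in the eigenvalue equation, after grouping the
    terms by the edge that they come from. *)
Lemma eigen_link_le (x : 'cV[complex R]_n) (lambda : complex R) i :
  tensor_apply (adjacency_tensor R G) x = lambda *: \col_j (x j 0 ^+ k.-1) ->
  normc lambda * normc (x i 0) ^+ k.-1
    <= link_form G (fun j => normc (x j 0)) i.
Proof.
move=> /matrixP/(_ i 0); rewrite !mxE -normcX -ComplexField.Normc.normcM => <-.
apply: le_trans (normc_sum _ _ _) _.
rewrite (bigID (fun s : k.-1.-tuple 'I_n => [set:: i :: s] \in edges G)) /=.
rewrite [X in _ + X]big1 ?addr0; last first.
  move=> s /negbTE sE; rewrite /adjacency_tensor sE mul0r.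
  exact: ComplexField.Normc.normc0.
rewrite (partition_big (fun s : k.-1.-tuple 'I_n => [set:: i :: s])
   (fun e => (e \in edges G) && (i \in e))) /=; last first.
  by move=> s ->; rewrite inE mem_head.
apply: ler_sum => e /andP[eE ie].
apply: le_trans (adjacency_fiber_le (fun j => normc_ge0 (x j 0)) eE ie).
rewrite le_eqVlt; apply/orP; left; apply/eqP; apply: eq_big => s.
  by case: eqVneq => [->|]; rewrite ?eE ?andbF.
move=> /andP[sE _].
by rewrite ComplexField.Normc.normcM /adjacency_tensor sE normc_natV normc_prod.
Qed.

(** Multiplying the bound of the previous lemma by the modulus of the [i]-th
    entry and summing over [i] gives [k%:R * edge_form] of the moduli on the
    right, so that any upper bound of the form on nonnegative vectors bounds
    all eigenvalues. *)
Lemma eigenvalue_modulus_le (mu : R) : (0 < k)%N ->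
  (forall y, (forall i, 0 <= y i) ->
     k%:R * edge_form G y <= mu * \sum_i y i ^+ k) ->
  forall r, eigenvalue_moduli G r -> r <= mu.
Proof.
move=> k0 hmu _ [lambda [x x0 Ex] <-].
pose y i := normc (x i 0); have y0 i : 0 <= y i by exact: normc_ge0.
have : normc lambda * \sum_i y i ^+ k <= mu * \sum_i y i ^+ k.
  apply: le_trans (hmu _ y0); rewrite -sum_link_form mulr_sumr.
  apply: ler_sum => i _; rewrite -[X in _ ^+ X](prednK k0) exprS mulrCA.
  by apply: ler_wpM2l => //; exact: eigen_link_le Ex.
rewrite ler_pM2r // lt_def sumr_ge0 ?andbT; last first.
  by move=> i _; rewrite exprn_ge0.
apply: contra_neq x0; move/eqP.
rewrite psumr_eq0; last by move=> i _; rewrite exprn_ge0.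
move=> /allP y_eq0; apply/colP => i; rewrite mxE.
apply: ComplexField.Normc.eq0_normc.
by have := y_eq0 i (mem_index_enum i); rewrite /= expf_eq0 k0 => /eqP.
Qed.

Lemma spectral_radius_le (mu : R) : (0 < k)%N -> 0 <= mu ->
  (forall y, (forall i, 0 <= y i) ->
     k%:R * edge_form G y <= mu * \sum_i y i ^+ k) ->
  spectral_radius R G <= mu.
Proof.
move=> k0 mu0 hmu; rewrite /spectral_radius.
(* The supremum of the empty set is 0. *)
have [->|/set0P nonempty] := eqVneq (@eigenvalue_moduli R k n G) set0.
  by rewrite sup0.
by apply: ge_sup nonempty _ => r; apply: eigenvalue_modulus_le.
Qed.

End Eigenvalues.

(** * A maximizer of the form *)

(** Convexity of the power function on nonnegative arguments. *)
Lemma exprn_tangent_le (R : realDomainType) (k : nat) (x t : R) :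
  0 <= x -> 0 <= t ->
  t ^+ k + k%:R * t ^+ k.-1 * (x - t) <= x ^+ k.
Proof.
move=> x0 t0; elim: k => [|k IHk]; first by rewrite !mul0r addr0.
rewrite (exprS x); apply: le_trans (ler_wpM2l x0 IHk) => /=.
rewrite -subr_ge0 -natr1; case: k {IHk} => [|k] /=.
  by rewrite !expr0 expr1; lra.
have -> : x * (t ^+ k.+1 + k.+1%:R * t ^+ k * (x - t)) -
  (t ^+ k.+2 + (k.+1%:R + 1) * t ^+ k.+1 * (x - t)) =
  k.+1%:R * t ^+ k * (x - t) ^+ 2.
  by rewrite !(exprS t); ring.
by rewrite mulr_ge0 ?sqr_ge0// mulr_ge0// exprn_ge0.
Qed.

Section Maximizer.
Local Open Scope classical_set_scope.

(** The first-order condition at a maximum on the half-line: the right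
    derivative is nonpositive.  Only [t > x] matters: there the tangent
    inequality at [t] gives [P <= mu * t ^+ k.-1], and [t] tends to [x]. *)
Lemma critical_point_le (R : realType) (k : nat) (mu P x : R) :
  (0 < k)%N -> 0 <= mu -> 0 <= x ->
  (forall t, 0 <= t ->
     k%:R * P * t - mu * t ^+ k <= k%:R * P * x - mu * x ^+ k) ->
  P <= mu * x ^+ k.-1.
Proof.
move=> k0 mu0 x0 hmax.
have kR : 0 < k%:R :> R by rewrite ltr0n.
have secant t : 0 <= t -> (t - x) * P <= (t - x) * (mu * t ^+ k.-1).
  move=> t0; rewrite -(ler_pM2l kR).
  have := hmax t t0; have := ler_wpM2l mu0 (exprn_tangent_le k x0 t0).
  clear -R; lra.
have cvgr : (mu * t ^+ k.-1 : R) @[t --> x^'+] --> mu * x ^+ k.-1.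
  apply: cvg_at_right_filter; apply: cvgM; first exact: cvg_cst.
  exact: exprn_continuous.
apply: (cvgr_to_ge cvgr); near=> t.
have xt : 0 < t - x by rewrite subr_gt0; near: t; exact: nbhs_right_gt.
rewrite -(ler_pM2l xt); apply: secant; apply: ltW; apply: le_lt_trans x0 _.
by rewrite -subr_gt0.
Unshelve. all: end_near.
Qed.

(** The continuous form has a maximum [x] on the compact set of nonnegative
    vectors with [\sum_i x i ^+ k = 1]; both sides of the last inequality are
    homogeneous of degree [k], which extends it to all nonnegative vectors. *)
Lemma edge_form_maximizer (R : realType) (k n : nat) (G : hypergraph k n) :
  (0 < k)%N -> (0 < n)%N ->
  exists x : 'I_n -> R, [/\ forall i, 0 <= x i, \sum_i x i ^+ k = 1 &
    forall y : 'I_n -> R, (forall i, 0 <= y i) ->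
      edge_form G y <= edge_form G x * \sum_i y i ^+ k].
Proof.
move=> k0 n0.
have coordc i : continuous (fun v : 'rV[R]_n => v ord0 i).
  exact: coord_continuous.
have sumc (I : finType) (P : pred I) (F : I -> 'rV[R]_n -> R) :
    (forall i, P i -> continuous (F i)) ->
    continuous (fun v => \sum_(i | P i) F i v).
  by apply: continuous_big; exact: add_continuous.
have prodc (P : pred 'I_n) (F : 'I_n -> 'rV[R]_n -> R) :
    (forall i, P i -> continuous (F i)) ->
    continuous (fun v => \prod_(i | P i) F i v).
  by apply: continuous_big; exact: mul_continuous.
have formc : continuous (fun v : 'rV[R]_n => edge_form G (v ord0)).
  by apply: sumc => e _; apply: prodc => i _; exact: coordc.
have powc : continuous (fun v : 'rV[R]_n => \sum_i v ord0 i ^+ k).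
  apply: sumc => i _ v.
  by apply: (@continuous_comp _ _ _ (fun v : 'rV[R]_n => v ord0 i)
    (fun t => t ^+ k)); [exact: coordc|exact: exprn_continuous].
pose A := [set v : 'rV[R]_n | forall i, `[0, 1] (v ord0 i)]
   `&` [set v : 'rV[R]_n | \sum_i v ord0 i ^+ k = 1].
have cA : compact A.
  apply: compact_closedI.
    exact: (@rV_compact R n (fun=> `[0, 1]) (fun=> @segment_compact R 0 1)).
  exact: (closed_comp (fun v _ => powc v) (@closed_eq _ 1)).
have inA (y : 'I_n -> R) :
    (forall i, 0 <= y i) -> \sum_i y i ^+ k = 1 -> A (\row_i y i).
  move=> y0 y1; split => /= [i|]; last by under eq_bigr do rewrite mxE.
  rewrite mxE in_itv /= y0 /= -(@expr_le1 _ k)// -y1 (bigD1 i) //= lerDl.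
  by apply: sumr_ge0 => j _; rewrite exprn_ge0.
have A0 : A !=set0.
  exists (\row_i (i == Ordinal n0)%:R); apply: inA => [i|]; first exact: ler0n.
  rewrite (bigD1 (Ordinal n0)) //= ?eqxx expr1n big1 ?addr0// => i /negbTE ->.
  by rewrite expr0n gtn_eqF.
have [v /set_mem[/= vseg v1] vmax] :=
  compact_EVT_max A0 cA (continuous_subspaceT formc).
have v0 i : 0 <= v ord0 i by have := vseg i; rewrite in_itv /= => /andP[].
exists (v ord0); split => // y y0.
set S := \sum_i y i ^+ k.
have yk0 i : 0 <= y i ^+ k by rewrite exprn_ge0.
have [S0|S_neq0] := eqVneq S 0.
  rewrite S0 mulr0 edge_form0 // => i; apply/eqP.
  move/eqP: S0; rewrite psumr_eq0// => /allP/(_ i (mem_index_enum i)).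
  by rewrite /= expf_eq0 k0.
have S_gt0 : 0 < S by rewrite lt_def S_neq0 sumr_ge0.
pose c := S `^ k%:R^-1.
have c0 : 0 < c by exact: powR_gt0.
have cS : c ^+ k = S.
  rewrite -powR_mulrn; last exact: ltW.
  by rewrite -powRrM mulVf ?pnatr_eq0 -?lt0n// powRr1// ltW.
have Ay : A (\row_i (y i / c)).
  apply: inA => [i|]; first by rewrite divr_ge0 // ltW.
  under eq_bigr do rewrite expr_div_n cS.
  by rewrite -mulr_suml divff.
have /= := vmax _ (mem_set Ay).
rewrite -(ler_pM2r S_gt0) => /(le_trans _); apply.
rewrite -cS mulrC -edge_formZ le_eqVlt; apply/orP; left; apply/eqP.
congr edge_form; apply: funext => i.
by rewrite mxE mulrC divfK // gt_eqF.
Qed.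
End Maximizer.

(** Varying one coordinate of the maximizer gives the inequality [<=] at every
    vertex, also at those where [x] vanishes.  Weighted by [x i] and summed,
    the two sides agree by Euler's identity, so equality holds wherever
    [x i != 0], and at the zeros of [x] the right-hand side is 0. *)
Lemma maximizer_eigen (R : realType) (k n : nat) (G : hypergraph k n)
    (x : 'I_n -> R) :
  (1 < k)%N -> (forall i, 0 <= x i) -> \sum_i x i ^+ k = 1 ->
  (forall y : 'I_n -> R, (forall i, 0 <= y i) ->
     edge_form G y <= edge_form G x * \sum_i y i ^+ k) ->
  forall i, link_form G x i = k%:R * edge_form G x * x i ^+ k.-1.
Proof.
move=> k1 x0 x1 xmax; set mu := k%:R * edge_form G x.
have k0 : (0 < k)%N by exact: ltnW.
have mu0 : 0 <= mu by rewrite mulr_ge0 // edge_form_ge0.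
have le_mu i : link_form G x i <= mu * x i ^+ k.-1.
  apply: critical_point_le => // t t0.
  have [c cE] := edge_form_split G x i.
  pose y (s : R) j := if j == i then s else x j.
  have yx : y (x i) = x.
    by apply: funext => j; rewrite /y; case: eqVneq => [->|].
  have y0 j : 0 <= y t j by rewrite /y; case: ifP.
  have sumy s : \sum_j y s j ^+ k = s ^+ k + \sum_(j | j != i) x j ^+ k.
    rewrite (bigD1 i) //= /y eqxx; congr (_ + _).
    by apply: eq_bigr => j /negbTE ->.
  have cx := cE (x i); rewrite -/(y (x i)) yx in cx.
  have := xmax _ y0; rewrite (cE t) sumy => /(ler_wpM2l (ler0n R k)).
  rewrite mulrA -/mu.
  have := sumy (x i); rewrite yx x1; set Q := \sum_(j | j != i) _ => sumx.
  have muQ : mu * Q = mu - mu * x i ^+ k by rewrite -{2}[mu]mulr1 sumx; ring.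
  have muE : mu = k%:R * (c + x i * link_form G x i) by rewrite /mu cx.
  rewrite [mu * (_ + Q)]mulrDr muQ => h.
  have {h muE} : k%:R * (c + t * link_form G x i)
      <= mu * t ^+ k + (k%:R * (c + x i * link_form G x i) - mu * x i ^+ k).
    by rewrite -muE.
  clear -R; lra.
have slack0 i : x i * (mu * x i ^+ k.-1 - link_form G x i) = 0.
  have slack_ge0 j : 0 <= x j * (mu * x j ^+ k.-1 - link_form G x j).
    by rewrite mulr_ge0// subr_ge0.
  have : \sum_j x j * (mu * x j ^+ k.-1 - link_form G x j) = 0.
    under eq_bigr do rewrite mulrBr mulrCA -exprS prednK//.
    by rewrite sumrB -mulr_sumr x1 sum_link_form mulr1 subrr.
  by move/psumr_eq0P => /(_ (fun j _ => slack_ge0 j) i isT).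
move=> i; have /eqP := slack0 i; rewrite mulf_eq0 => /predU1P[xi0|].
  have := le_mu i; rewrite xi0 expr0n.
  rewrite (_ : (k.-1 == 0)%N = false) ?mulr0; last lia.
  by move=> le0; apply: le_anti; rewrite le0 link_form_ge0.
by rewrite subr_eq0 => /eqP.
Qed.

(** * The extreme entries of an eigenvector *)

Section Principal.

Variables (R : realType) (k n : nat) (G : hypergraph k n).
Variables (x : 'I_n -> R) (mu : R) (top bot : 'I_n).
Hypotheses (k_gt1 : (1 < k)%N) (G_irr : irregular G) (G_conn : connected G).
Hypotheses (x_ge0 : forall i, 0 <= x i) (x_unit : \sum_i x i ^+ k = 1).
Hypothesis x_eigen : forall i, link_form G x i = mu * x i ^+ k.-1.
Hypotheses (x_top : forall i, x i <= x top) (x_bot : forall i, x bot <= x i).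

Let Delta : R := (max_degree G)%:R.
Let delta : R := (min_degree G)%:R.

Let n_gt1 : (1 < n)%N := irregular_card_gt1 G_irr.
Let n_gt0 : (0 < n)%N := ltnW n_gt1.

Lemma min_lt_max_degree : (min_degree G < max_degree G)%N.
Proof.
have [j] := irregular_lt_max G_irr; exact: leq_ltn_trans (min_degree_le G j).
Qed.

Lemma min_degree_gt0 : (0 < min_degree G)%N.
Proof.
by have [v <-] := min_degree_attained G n_gt0; exact: connected_degree_gt0.
Qed.

Lemma max_entry_gt0 : 0 < x top.
Proof.
rewrite lt_def x_ge0 andbT; apply/eqP => top0.
have : \sum_i x i ^+ k = 0.
  apply: big1 => i _; have -> : x i = 0.
    by apply: le_anti; rewrite x_ge0 -top0 x_top.
  by rewrite expr0n gtn_eqF // ltnW.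
by rewrite x_unit => /eqP; rewrite oner_eq0.
Qed.

Lemma eigenvalue_ge0 : 0 <= mu.
Proof.
rewrite -(@pmulr_lge0 _ (x top ^+ k.-1)) ?exprn_gt0 ?max_entry_gt0 // -x_eigen.
exact: link_form_ge0.
Qed.

(** The eigenvalue equation at a vertex of maximum degree. *)
Lemma max_degree_eigen_le : Delta * x bot ^+ k.-1 <= mu * x top ^+ k.-1.
Proof.
have [u uE] := max_degree_attained G n_gt0.
apply: (@le_trans _ _ (mu * x u ^+ k.-1)).
  by rewrite -x_eigen /Delta -uE; apply: link_form_ge.
by apply: (ler_wpM2l eigenvalue_ge0); apply: lerXn2r; rewrite ?nnegrE.
Qed.

(** The eigenvalue equation at a vertex of minimum degree. *)
Lemma min_degree_eigen_ge : mu * x bot ^+ k.-1 <= delta * x top ^+ k.-1.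
Proof.
have [v vE] := min_degree_attained G n_gt0.
apply: (@le_trans _ _ (mu * x v ^+ k.-1)).
  by apply: (ler_wpM2l eigenvalue_ge0); apply: lerXn2r; rewrite ?nnegrE.
rewrite -x_eigen /delta -vE; apply: link_form_le => j.
by rewrite x_ge0 x_top.
Qed.

Lemma min_entry_lt_max : x bot < x top.
Proof.
rewrite lt_neqAle x_top andbT; apply/eqP => bot_top.
have := le_trans max_degree_eigen_le (le_trans _ min_degree_eigen_ge).
rewrite bot_top lexx => /(_ isT).
rewrite ler_pM2r ?exprn_gt0 ?max_entry_gt0 // ler_nat leqNgt.
by rewrite min_lt_max_degree.
Qed.

(** If [bot] is the only vertex with a non-maximal entry, bounding the other
    terms of [\sum_i x i ^+ k] by [x top ^+ k] loses nothing, and strictness has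
    to come from the eigenvalue equation.  It does so at a vertex [u] of maximum
    degree: the other vertices of the edges at [u] cannot all be [bot]. *)
Lemma max_degree_eigen_lt : 0 < x bot -> (forall i, i != bot -> x i = x top) ->
  Delta * x bot ^+ k.-1 < mu * x top ^+ k.-1.
Proof.
move=> bot_gt0 xE; have [u uE] := max_degree_attained G n_gt0.
have k1_gt0 : (0 < k.-1)%N by rewrite -ltnS prednK // ltnW.
have Delta_gt0 : 0 < Delta.
  by rewrite ltr0n; apply: leq_ltn_trans min_lt_max_degree.
have powlt : x bot ^+ k.-1 < x top ^+ k.-1.
  by rewrite ltrXn2r ?nnegrE // ?min_entry_lt_max ?lt0n_neq0 // -lt0n.
have [u_bot|u_bot] := eqVneq u bot.
  apply: (@lt_le_trans _ _ (Delta * x top ^+ k.-1)); first by rewrite ltr_pM2l.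
  have : Delta * x top ^+ k.-1 <= mu * x bot ^+ k.-1.
    rewrite -x_eigen /Delta -uE u_bot; apply: link_form_ge => // j /xE ->.
    exact: lexx.
  by move=> /le_trans; apply; apply: (ler_wpM2l eigenvalue_ge0); exact: ltW.
rewrite -(xE _ u_bot) -x_eigen /Delta -uE.
(* Some edge at u may contain a third vertex z, which has the maximal entry. *)
have [/existsP[e /andP[/andP[eE ue] /existsP[z /and3P[ze zu zbot]]]]|] :=
  boolP [exists e : {set 'I_n}, (e \in edges G) && (u \in e) &&
     [exists z, [&& z \in e, z != u & z != bot]]].
  rewrite degreeE mulr_suml /link_form.
  rewrite (bigD1 e) ?eE //= [ltRHS](bigD1 e) ?eE //=.
  apply: ltr_leD; last first.
    apply: ler_sum => f /andP[/andP[fE uf] _].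
    by rewrite mul1r; apply: (prod_edgeD1_ge _ _ fE uf) => //.
  rewrite mul1r (big_setD1 z) ?inE ?zu //=.
  rewrite -[X in x bot ^+ X](prednK k1_gt0) exprS.
  rewrite (xE z zbot); apply: (@lt_le_trans _ _ (x top * x bot ^+ k.-2)).
    by rewrite ltr_pM2r ?min_entry_lt_max // exprn_gt0.
  apply: ler_wpM2l; first exact: x_ge0.
  have -> : k.-2 = #|e :\ u :\ z|.
    rewrite -(card_edge eE) (cardsD1 u e) ue.
    by rewrite (cardsD1 z (e :\ u)) !inE zu ze.
  by rewrite -prodr_const; apply: ler_prod => j _; rewrite x_ge0 x_bot.
(* Otherwise [set u; bot] is the only edge at u, so the maximum degree is 1 and
   the minimum degree 0, which connectedness excludes. *)
move=> /existsPn noz; exfalso.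
suff : (max_degree G <= 1)%N.
  rewrite leqNgt => /negP; apply; apply: leq_ltn_trans min_lt_max_degree.
  exact: min_degree_gt0.
rewrite -uE -(cards1 [set u; bot]) ; apply: subset_leq_card.
apply/fintype.subsetP => e; rewrite !inE => /andP[eE ue].
have := noz e; rewrite eE ue /= => /existsPn noze.
rewrite eqEcard (card_edge eE) cards2 (leq_trans _ k_gt1) ?andbT; last first.
  by case: (_ != _).
apply/fintype.subsetP => z ze; have := noze z; rewrite ze /= !inE.
by rewrite negb_and !negbK.
Qed.

(** Every term of [\sum_i x i ^+ k = 1] is at most [x top ^+ k], and the term at
    [bot] is at most [theta * x top ^+ k]: multiplying the eigenvalue
    inequalities at the vertices of maximum and minimum degree eliminates [mu]
    and leaves [Delta * x bot ^+ (2 * k.-1) <= delta * x top ^+ (2 * k.-1)]. *)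
Lemma max_entry_power_gt :
  1 < x top ^+ k * ((delta / Delta) `^ (k%:R / (2 * (k%:R - 1))) + n%:R - 1).
Proof.
set theta := _ `^ _.
have Delta_gt0 : 0 < Delta.
  by rewrite ltr0n; apply: leq_ltn_trans min_lt_max_degree.
have delta_gt0 : 0 < delta by rewrite ltr0n min_degree_gt0.
have a0 := max_entry_gt0.
pose z := x bot / x top.
have z0 : 0 <= z by rewrite divr_ge0.
have r0 : 0 <= delta / Delta by rewrite divr_ge0 // ltW.
have ak_gt0 m : 0 < x top ^+ m by rewrite exprn_gt0.
have zk : x bot ^+ k = z ^+ k * x top ^+ k.
  by rewrite -exprMn divfK // gt_eqF.
have [thetaW thetaS] := powR_half_ratio k_gt1 z0 r0.
have zsq : z ^+ k.-1 ^+ 2 = (x bot ^+ k.-1) ^+ 2 / (x top ^+ k.-1) ^+ 2.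
  by rewrite !expr_div_n.
have z_le : z ^+ k <= theta.
  apply: thetaW; rewrite zsq ler_pdivrMr ?exprn_gt0 // mulrAC ler_pdivlMr //.
  have := ler_wpM2r (exprn_ge0 k.-1 (x_ge0 bot)) max_degree_eigen_le.
  have := ler_wpM2r (ltW (ak_gt0 k.-1)) min_degree_eigen_ge.
  rewrite !expr2; lra.
have pow_top i : x i ^+ k <= x top ^+ k by apply: lerXn2r; rewrite ?nnegrE.
have sum_top : \sum_(i | i != bot) x top ^+ k = (n%:R - 1) * x top ^+ k.
  rewrite (eq_bigl (fun i => i \in [set~ bot])); last by move=> i; rewrite !inE.
  by rewrite sumr_const cardsC1 card_ord -[LHS]mulr_natl -subn1 natrB.
have others : \sum_(i | i != bot) x i ^+ k <= (n%:R - 1) * x top ^+ k.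
  by rewrite -sum_top; apply: ler_sum.
have split1 : 1 = x bot ^+ k + \sum_(i | i != bot) x i ^+ k.
  by rewrite -x_unit (bigD1 bot).
rewrite [ltLHS]split1 zk.
have -> : x top ^+ k * (theta + n%:R - 1) =
    theta * x top ^+ k + (n%:R - 1) * x top ^+ k by ring.
have [z_lt|z_ge] := ltP (z ^+ k) theta; first by rewrite ltr_leD // ltr_pM2r.
have zE : z ^+ k = theta by apply: le_anti; rewrite z_le z_ge.
have bot_gt0 : 0 < x bot.
  have theta_gt0 : 0 < theta by rewrite powR_gt0 // divr_gt0.
  rewrite lt_def x_ge0 andbT; apply: contraTneq theta_gt0 => bot0.
  by rewrite -zE /z bot0 mul0r expr0n gtn_eqF ?ltxx // ltnW.
rewrite ler_ltD //; first by rewrite zE.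
have [/existsP[i /andP[i_bot i_lt]]|] :=
  boolP [exists i, (i != bot) && (x i < x top)].
  rewrite -sum_top (bigD1 i) //= [ltRHS](bigD1 i) //=; apply: ltr_leD.
    by rewrite ltrXn2r ?nnegrE // -lt0n ltnW.
  exact: ler_sum.
move=> /existsPn no_lt; exfalso.
have xE i : i != bot -> x i = x top.
  move=> i_bot; apply: le_anti; rewrite x_top /= leNgt.
  by have := no_lt i; rewrite i_bot.
have := max_degree_eigen_lt bot_gt0 xE => mu_gt.
suff /thetaS : z ^+ k.-1 ^+ 2 < delta / Delta by rewrite zE ltxx.
rewrite zsq ltr_pdivrMr ?exprn_gt0 // mulrAC ltr_pdivlMr //.
have bk_gt0 : 0 < x bot ^+ k.-1 by rewrite exprn_gt0.
move: mu_gt; rewrite -(ltr_pM2r bk_gt0).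
have := ler_wpM2r (ltW (ak_gt0 k.-1)) min_degree_eigen_ge.
rewrite !expr2; lra.
Qed.
End Principal.

(** * The gap between the maximum degree and the maximum of the form *)

Section Gap.

Variables (R : realType) (k n : nat) (G : hypergraph k n).
Variables (x : 'I_n -> R) (top bot : 'I_n).
Hypotheses (k_gt1 : (1 < k)%N) (G_conn : connected G).
Hypotheses (x_ge0 : forall i, 0 <= x i) (x_unit : \sum_i x i ^+ k = 1).
Hypotheses (x_bot : forall i, x bot <= x i).

Let K : R := k%:R.
Let Delta : R := (max_degree G)%:R.
Let D : R := (diameter G)%:R.
Let A : R := n%:R * Delta - K * (num_edges G)%:R.
Let defect (e : {set 'I_n}) : R :=
  \sum_(j in e) x j ^+ k - K * \prod_(j in e) x j.
Let E : R := \sum_(e in edges G) defect e.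

Lemma degree_deficit : A = \sum_i (Delta - (degree G i)%:R).
Proof.
by rewrite sumrB handshake sumr_const card_ord -[_ *+ n]mulr_natl natrM.
Qed.

Lemma degree_deficit_ge0 : 0 <= A.
Proof.
rewrite degree_deficit; apply: sumr_ge0 => i _.
by rewrite subr_ge0 ler_nat max_degree_ge.
Qed.

Lemma degree_deficit_gt0 : irregular G -> 0 < A.
Proof.
move=> /irregular_lt_max[i lt_i]; rewrite degree_deficit (bigD1 i) //=.
apply: ltr_pwDl; first by rewrite subr_gt0 ltr_nat.
by apply: sumr_ge0 => j _; rewrite subr_ge0 ler_nat max_degree_ge.
Qed.

(** [Delta - K * edge_form G x] splits, by [x_unit], into
    [\sum_i (Delta - d_i) * x i ^+ k], with the degrees [d_i], and the total
    defect [E] of the inequality between arithmetic and geometric means. *)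
Lemma gap_ge : A * x bot ^+ k + E <= Delta - K * edge_form G x.
Proof.
have -> : E = \sum_i (degree G i)%:R * x i ^+ k - K * edge_form G x.
  by rewrite sum_degree /E /defect sumrB mulr_sumr.
have -> : Delta = \sum_i Delta * x i ^+ k by rewrite -mulr_sumr x_unit mulr1.
rewrite addrA lerD2r -lerBrDr -sumrB degree_deficit mulr_suml.
apply: ler_sum => i _.
rewrite -mulrBl ler_wpM2l ?subr_ge0 ?ler_nat ?max_degree_ge //.
by apply: lerXn2r; rewrite ?nnegrE.
Qed.

Lemma defect_ge e p q : e \in edges G -> p \in e -> q \in e ->
  K * (Num.sqrt (x p) ^+ k - Num.sqrt (x q) ^+ k) ^+ 2
    <= 2 * (K - 1) * defect e.
Proof.
move=> eE pe qe; have ek := card_edge eE.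
have e_gt1 : (1 < #|e|)%N by rewrite ek.
by have := edge_defect_ge e_gt1 x_ge0 pe qe; rewrite ek.
Qed.

Lemma K_gt1 : 1 < K. Proof. by rewrite ltr1n. Qed.

Lemma defect_ge0 e : e \in edges G -> 0 <= defect e.
Proof.
move=> eE; have /card_gt0P[p pe] : (0 < #|e|)%N by rewrite (card_edge eE) ltnW.
have := defect_ge eE pe pe; rewrite subrr expr0n mulr0 pmulr_rge0 //.
have := K_gt1; lra.
Qed.

(** The defects of the edges of a shortest path from [top] to [bot] suffice. *)
Lemma defect_sum_ge :
  K * (Num.sqrt (x top) ^+ k - Num.sqrt (x bot) ^+ k) ^+ 2
    <= 2 * (K - 1) * D * E.
Proof.
have K1 := K_gt1.
have E0 : 0 <= E by apply: sumr_ge0 => e; exact: defect_ge0.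
have [->|top_bot] := eqVneq top bot.
  rewrite subrr expr0n mulr0 mulr_ge0 // mulr_ge0 ?ler0n //; lra.
have [top_to_bot _] := distP (G_conn top bot).
have := path_energy_le (c := K) (W := fun e => 2 * (K - 1) * defect e) _ _
  defect_ge top_to_bot.
move=> /(_ (ler0n _ _)) /(_ _)/le_trans; apply.
  by move=> e eE; rewrite mulr_ge0 ?defect_ge0 //; lra.
rewrite -mulr_sumr -/E mulrCA -mulrA ler_wpM2l //; first lra.
by rewrite ler_wpM2r // ler_nat dist_le_diameter.
Qed.

(** A small entry at [bot] makes the defects large, and a large one makes the
    degree term [A * x bot ^+ k] large; this is the worst case. *)
Lemma gap_lower_bound :
  K * A * x top ^+ k <= (2 * (K - 1) * D * A + K) * (Delta - K * edge_form G x).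
Proof.
have K1 := K_gt1; have A0 := degree_deficit_ge0.
have c0 : 0 <= 2 * (K - 1) * D by rewrite mulr_ge0 ?ler0n //; lra.
have E0 : 0 <= E by apply: sumr_ge0 => e; exact: defect_ge0.
have sqr_sqrt i : x i ^+ k = (Num.sqrt (x i) ^+ k) ^+ 2.
  by rewrite exprAC sqr_sqrtr.
rewrite sqr_sqrt.
apply: le_trans (quadratic_tradeoff A0 E0 c0 (ler0n _ _) defect_sum_ge) _.
rewrite -sqr_sqrt; apply: ler_wpM2l gap_ge.
by rewrite addr_ge0 ?ler0n // mulr_ge0.
Qed.

End Gap.

Theorem theorem3p6 (R : realType) (k n : nat) (G : hypergraph k n)
    (k_ge2 : (2 <= k)%N) (G_irregular : irregular G)
    (G_connected : connected G) :
  let K : R := k%:R in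
  let N : R := n%:R in
  let m : R := (num_edges G)%:R in
  let Delta : R := (max_degree G)%:R in
  let delta : R := (min_degree G)%:R in
  let D : R := (diameter G)%:R in
  spectral_radius R G <
    Delta - K * (N * Delta - K * m) /
      ((2 * (K - 1) * D * (N * Delta - K * m) + K) *
       ((delta / Delta) `^ (K / (2 * (K - 1))) + N - 1)).
Proof.
cbv zeta; set K : R := k%:R; set N : R := n%:R; set m : R := (num_edges G)%:R.
set Delta : R := (max_degree G)%:R; set delta : R := (min_degree G)%:R.
set D : R := (diameter G)%:R.
have k_gt0 : (0 < k)%N by exact: ltnW.
have n_gt0 : (0 < n)%N by apply: ltnW; exact: irregular_card_gt1 G_irregular.
have [x [x_ge0 x_unit x_max]] := edge_form_maximizer R G k_gt0 n_gt0.
have x_eigen := maximizer_eigen k_ge2 x_ge0 x_unit x_max.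
have [top x_top] : exists i, forall j, x j <= x i.
  case: (arg_maxP x (isT : xpredT (Ordinal n_gt0))) => i _ h.
  by exists i => j; exact: h.
have [bot x_bot] : exists i, forall j, x i <= x j.
  case: (arg_minP x (isT : xpredT (Ordinal n_gt0))) => i _ h.
  by exists i => j; exact: h.
have A_gt0 := degree_deficit_gt0 R G_irregular.
have gap := gap_lower_bound top k_ge2 G_connected x_ge0 x_unit x_bot.
have big_top := max_entry_power_gt k_ge2 G_irregular G_connected
  x_ge0 x_unit x_eigen x_top x_bot.
apply: (@le_lt_trans _ _ (K * edge_form G x)).
  apply: spectral_radius_le => // [|y y_ge0].
    by rewrite mulr_ge0 ?ler0n // edge_form_ge0.
  by rewrite -mulrA ler_wpM2l ?ler0n // x_max.
move: A_gt0 gap big_top; rewrite -/K -/N -/m -/Delta -/delta -/D.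
set A := N * Delta - K * m; set T := _ + N - 1 => A_gt0 gap big_top.
have K_gt0 : 0 < K by rewrite ltr0n.
have c_ge0 : 0 <= 2 * (K - 1) * D * A.
  rewrite mulr_ge0 ?(ltW A_gt0)// mulr_ge0 ?ler0n//.
  by rewrite mulr_ge0 // subr_ge0 ler1n.
have B_gt0 : 0 < 2 * (K - 1) * D * A + K by lra.
have top_ge0 : 0 <= x top ^+ k by rewrite exprn_ge0.
have T_gt0 : 0 < T.
  rewrite ltNge; apply/negP => T_le0.
  by have := mulr_ge0_le0 top_ge0 T_le0; lra.
rewrite ltrBrDl -ltrBrDr ltr_pdivrMr ?mulr_gt0 // mulrA (mulrC (_ - _)).
apply: lt_le_trans (ler_wpM2r (ltW T_gt0) gap).
by rewrite -[ltRHS]mulrA ltr_pMr ?mulr_gt0.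
Qed.
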